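(* Let $\mu$ be an ergodic measure on a symbolic system $(X,T)$ and let $L$ be the language of $X$. Let $u$ and $t$ be two words of $L$ such that $uat\notin L$ for all $a\in L$. Then $\mu({}_0[t])=0$ or $\mu({}_0[u])=0$.
   Context: A symbolic dynamical system $(X,T)$ is a closed shift-invariant set $X$ of two-sided sequences over a finite alphabet, with $T$ the shift; its language $L$ is the set of finite words (including the empty word) occurring as factors of sequences of $X$. For a word $w=w_1\cdots w_k\in L$, ${}_0[w]$ is the cylinder $\{(x_i)_{i\in\mathbb{Z}}\in X: x_0x_1\cdots x_{k-1}=w_1\cdots w_k\}$. An ergodic measure is a $T$-invariant ergodic Borel probability measure. *)

(* Defs.v *)
From HB Require Import structures.
From mathcomp Require Import all_boot all_order all_algebra.
From mathcomp Require Import all_classical all_reals all_analysis.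

Set Implicit Arguments.
Unset Strict Implicit.
Unset Printing Implicit Defensive.

Import Order.TTheory GRing.Theory Num.Theory.

Local Open Scope classical_set_scope.
Local Open Scope ring_scope.

(* Two-sided sequences over the finite alphabet [A], with the product of the
   discrete topologies. *)
Definition full_shift (A : finType) : Type :=
  {ptws int -> discrete_topology A}.

HB.instance Definition _ (A : finType) :=
  Topological.copy (full_shift A) {ptws int -> discrete_topology A}.

Definition shift_map (A : finType) (x : full_shift A) : full_shift A :=
  fun i : int => x (i + 1).

(* Nonemptiness costs nothing, since the empty system carries no probability
   measure; the library requires measurable types to be pointed. *)
Record symbolicSystem (A : finType) := SymbolicSystem {
  system_set : set (full_shift A);
  system_nonempty : system_set !=set0;
  system_closed : closed system_set;
  system_shift : @shift_map A @` system_set = system_set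
}.

(* The space [X] itself, as a subtype of the full shift carrying the induced
   topology; its measurable sets are the Borel sets of that topology. *)
Definition system_space (A : finType) (X : symbolicSystem A) : Type :=
  set_type (system_set X).

HB.instance Definition _ (A : finType) (X : symbolicSystem A) :=
  Topological.copy (system_space X) (set_type (system_set X)).

Definition system_point (A : finType) (X : symbolicSystem A) : system_space X :=
  let: exist x Xx := cid (system_nonempty X) in exist _ x (mem_set Xx).

HB.instance Definition _ (A : finType) (X : symbolicSystem A) :=
  isPointed.Build (system_space X) (system_point X).

HB.instance Definition _ (A : finType) (X : symbolicSystem A) :=
  Measurable.copy (system_space X)
    (g_sigma_algebraType (@open (system_space X))).

Lemma shift_map_system (A : finType) (X : symbolicSystem A)
    (x : system_space X) : shift_map (\val x) \in system_set X.
Proof.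
apply/mem_set; rewrite -[X in X _]system_shift.
by exists (\val x) => //; exact/set_mem/(valP x).
Qed.

Definition system_map (A : finType) (X : symbolicSystem A)
    (x : system_space X) : system_space X :=
  exist _ (shift_map (\val x)) (shift_map_system x).

Definition invariant_measure (A : finType) (X : symbolicSystem A)
    (R : realType) (mu : probability (system_space X) R) : Prop :=
  forall B : set (system_space X), measurable B ->
    mu (@system_map A X @^-1` B) = mu B.

Definition ergodic_measure (A : finType) (X : symbolicSystem A)
    (R : realType) (mu : probability (system_space X) R) : Prop :=
  invariant_measure mu /\
  forall B : set (system_space X), measurable B ->
    @system_map A X @^-1` B = B -> mu B = 0%E \/ mu B = 1%E.

(* The word [x_i x_(i+1) ... x_(i+n-1)]. *)
Definition factor (A : finType) (x : full_shift A) (i : int) (n : nat) : seq A :=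
  mkseq (fun k => x (i + k%:Z)) n.

Definition language (A : finType) (X : symbolicSystem A) : set (seq A) :=
  [set w | exists (x : system_space X) (i : int),
    factor (\val x) i (size w) = w].

Definition cylinder (A : finType) (X : symbolicSystem A) (w : seq A) :
    set (system_space X) :=
  [set x | factor (\val x) 0 (size w) = w].

Arguments cylinder {A} X w.

(* Main.v *)
Require Import Defs.
From mathcomp Require Import all_boot all_order all_algebra.
From mathcomp Require Import all_classical all_reals all_analysis.

(** Write [T] for the shift and let [E] be the set of points whose orbit meets
    [t] at arbitrarily late times: the upper limit of the sets
    [T^-n (cylinder t)].  This set is strictly invariant ([T^-1 E = E]), so by
    ergodicity it has measure 0 or 1.

    It is at least as likely as [t] ([measure_le_lim_sup_preimage]): the tails
    [\bigcup_(n >= m) T^-n (cylinder t)] decrease to [E], and each is the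
    preimage under [T] of the one before, so they all have the same measure,
    and the first contains the cylinder of [t].  Hence [mu E = 0] forces [t]
    to be null.

    If [mu E = 1] then [u] is null, because its cylinder is disjoint from [E]:
    a point of both would read [u] at time 0 and [t] at some time
    [n >= size u], and the word [a] that it reads between the two would give
    [u ++ a ++ t] in the language ([language_link]). *)

Set Implicit Arguments.
Unset Strict Implicit.
Unset Printing Implicit Defensive.

Import Order.TTheory GRing.Theory Num.Theory.

Local Open Scope classical_set_scope.
Local Open Scope ring_scope.

(** Removing the first set of the sequence does not change the upper limit;
    hence it is strictly invariant, and not merely invariant up to a null
    set. *)
Lemma preimage_lim_sup_set (T : Type) (f : T -> T) (F : (set T)^nat) :
  (forall n, f @^-1` F n = F n.+1) -> f @^-1` lim_sup_set F = lim_sup_set F.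
Proof.
move=> fF; have fFE n x : F n (f x) = F n.+1 x by rewrite -fF.
apply/seteqP; split => x Ex m _.
- have [k /= mk Fk] := Ex m I.
  by exists k.+1; [exact: leqW | rewrite -fFE].
- have [[//|k] /= mk Fk] := Ex m.+1 I.
  by exists k => //; rewrite fFE.
Qed.

(** A form of Poincare recurrence: the tails [\bigcup_(k >= m) F k] are
    successive preimages of one another, hence of equal measure, and for a
    finite measure this passes to their decreasing limit. The iterated preimages
    of [F 0] form a sequence given in advance because, for the cylinder of a
    word, they have a description by coordinates from which they are readily
    seen to be measurable. *)
Lemma measure_le_lim_sup_preimage (d : measure_display) (T : measurableType d)
    (R : realType) (mu : probability T R) (f : T -> T) (F : (set T)^nat) :
  (forall B, measurable B -> mu (f @^-1` B) = mu B) ->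
  (forall n, measurable (F n)) -> (forall n, f @^-1` F n = F n.+1) ->
  (mu (F 0%N) <= mu (lim_sup_set F))%E.
Proof.
move=> mu_inv mF fF.
have mtail m : measurable (\bigcup_(k in [set k | (m <= k)%N]) F k).
  exact: bigcup_measurable.
have tailE m : mu (\bigcup_(k in [set k | (m <= k)%N]) F k)
             = mu (\bigcup_(k in [set k | (0 <= k)%N]) F k).
  elim: m => // m <-; rewrite -[RHS]mu_inv//; congr (mu _).
  rewrite preimage_bigcup; apply/seteqP; split => x [].
  - by case=> [//|k] /= mk Fk; exists k => //; rewrite fF.
  - by move=> k /= mk Fk; exists k.+1 => //; rewrite -fF.
have cvg_tail : mu (\bigcup_(k in [set k | (m <= k)%N]) F k)
    @[m --> \oo] --> mu (lim_sup_set F).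
  apply: lim_sup_set_cvg => //.
  by rewrite (le_lt_trans (probability_le1 _ _))// ltry.
have -> : mu (lim_sup_set F) = mu (\bigcup_(k in [set k | (0 <= k)%N]) F k).
  apply: (cvg_unique _ cvg_tail); first exact: ereal_hausdorff.
  by apply: cvg_near_cst; apply: nearW => m; exact: tailE.
by apply: le_measure; rewrite ?inE//; exact: (bigcup_sup (i := 0%N)).
Qed.

Section symbolic_system.
Context {A : finType} {X : symbolicSystem A}.
Implicit Types (x : system_space X) (w u t : seq A).

(** The preimage of the cylinder of [w] under the [n]-th iterate of the shift,
    written through coordinates so that it is visibly a finite intersection of
    conditions on single letters; [occurrence w 0] is [cylinder X w] by
    conversion. *)
Definition occurrence w (n : nat) : set (system_space X) :=
  [set x | Defs.factor (\val x) n%:Z (size w) = w].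

Lemma factor_shift_map (y : full_shift A) (i : int) (n : nat) :
  Defs.factor (shift_map y) i n = Defs.factor y (i + 1) n.
Proof. by apply: eq_mkseq => k; rewrite /shift_map addrAC. Qed.

Lemma preimage_occurrence w n :
  @system_map A X @^-1` occurrence w n = occurrence w n.+1.
Proof.
by rewrite /occurrence -addn1 PoszD /preimage /=; under eq_set do
  rewrite factor_shift_map.
Qed.

Lemma measurable_coordinate (i : int) (a : A) :
  measurable [set x : system_space X | \val x i = a].
Proof.
apply: sub_sigma_algebra.
have /continuousP coord_open :
    continuous (fun y : full_shift A => y i : discrete_topology A).
  exact: (@proj_continuous int (fun=> discrete_topology A) i).
exists [set y : full_shift A | y i = a] => //.
exact: (coord_open [set a] (discrete_open _)).
Qed.

Lemma measurable_occurrence w n : measurable (occurrence w n).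
Proof.
case: w => [|a0 w].
  by rewrite (_ : occurrence _ _ = setT)//; apply/seteqP; split.
rewrite (_ : occurrence _ _ =
    \bigcap_(k in [set k | (k < size (a0 :: w))%N])
      [set x : system_space X | \val x (n%:Z + k%:Z) = nth a0 (a0 :: w) k]).
  apply: bigcap_measurableType => // k _; exact: measurable_coordinate.
apply/seteqP; split => x xw.
- by move=> k /= kw; rewrite -[in RHS]xw nth_mkseq.
- apply: (@eq_from_nth _ a0); first by rewrite size_mkseq.
  by move=> k; rewrite size_mkseq => kw; rewrite nth_mkseq//; exact: xw.
Qed.

Lemma factorD (y : full_shift A) (i : int) (m n : nat) :
  Defs.factor y i (m + n) = Defs.factor y i m ++ Defs.factor y (i + m%:Z) n.
Proof.
rewrite /Defs.factor /mkseq iotaD map_cat add0n; congr (_ ++ _).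
rewrite -[m in iota m]addn0 iotaDl -map_comp.
by apply: eq_map => k /=; rewrite PoszD addrA.
Qed.

Lemma language_factor x (i : int) (n : nat) :
  language X (Defs.factor (\val x) i n).
Proof. by exists x, i; rewrite size_mkseq. Qed.

(** The condition on [n] keeps the two words from overlapping, so that there is
    a word, possibly empty, between them. *)
Lemma language_link u t x n : (size u <= n)%N ->
  cylinder X u x -> occurrence t n x ->
  exists2 a, language X a & language X (u ++ a ++ t).
Proof.
move=> un ux tx; exists (Defs.factor (\val x) (size u)%:Z (n - size u)).
  exact: language_factor.
have -> : u ++ Defs.factor (\val x) (size u)%:Z (n - size u) ++ t =
    Defs.factor (\val x) 0 (size u + (n - size u + size t)).
  by rewrite !factorD add0r -PoszD subnKC// ux tx.
exact: language_factor.
Qed.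

End symbolic_system.

Theorem theorem6 (R : realType) (A : finType) (X : symbolicSystem A)
    (mu : probability (system_space X) R) (mu_ergodic : ergodic_measure mu)
    (u t : seq A) (Lu : language X u) (Lt : language X t)
    (no_link : forall a : seq A, language X a ->
       ~ language X (u ++ a ++ t)) :
  mu (cylinder X t) = 0%E \/ mu (cylinder X u) = 0%E.
Proof.
have [mu_inv mu_erg] := mu_ergodic.
pose E := lim_sup_set (@occurrence A X t).
have mE : measurable E.
  apply: bigcap_measurableType => // m _; apply: bigcup_measurable => n _.
  exact: measurable_occurrence.
have [E0|E1] := mu_erg _ mE (preimage_lim_sup_set (preimage_occurrence t)).
- left; apply/eqP; rewrite eq_le measure_ge0 andbT -E0.
  apply: (@measure_le_lim_sup_preimage _ _ _ mu (@system_map A X)) => //.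
  + exact: measurable_occurrence.
  + exact: preimage_occurrence.
- right; apply: (@subset_measure0 _ _ _ mu _ (~` E)).
  + exact: (measurable_occurrence u 0).
  + exact: measurableC.
  + (* Points of [E] read [t] at arbitrarily late times, in particular at one
       past the end of the word [u] read at time 0. *)
    move=> x ux Ex; have [n /= un tx] := Ex (size u) I.
    by have [a La] := language_link un ux tx; exact: no_link.
  + by have := probability_setC mu mE; rewrite E1 subee.
Qed.
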